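(* Let $p\in\Delta_{m-1}$ and let $f_2(u,X)=-\sum_{j=1}^mp_j\langle S_{T+1}(j),X_T(j^-)\rangle+\iota_{\mathcal X(u)}(X)$ for $(u,X)\in\mathbb R^{N_T}\times\mathbb R^n$, with associated dual function $\psi_2:\mathbb R^{N_T}\to\overline{\mathbb R}$. Let $\varphi(X)=f_2(0,X)=-\sum_{j=1}^mp_j\langle S_{T+1}(j),X_T(j^-)\rangle+\iota_{\mathcal X(0)}(X)$. Then $$\sup_{y\in\mathbb R^{N_T}}\psi_2(y)=\min_{X\in\mathbb R^n}\varphi(X).$$
   Context: Scenario tree. Let $T,k\ge 1$ be integers and consider a finite rooted tree with levels $0,1,\dots,T+1$ (the history tree of a finitely supported discrete-time environment process), in which every node at a level $\le T$ has at least one child. For $0\le t\le T$, $I_t$ is the set of nodes at level $t$ ($I_0$ consists of the root), $n_t=|I_t|$, $N_T=\sum_{t=0}^T n_t$, $n=(k+1)N_T$. The terminal nodes (level $T+1$) are labeled $1,\dots,m$. For a node $i$, $i^-$ is its parent and $i^+$ its set of children. The terminal nodes are partitioned into original scenarios $I$ and added critical scenarios $\tilde I$ (all nodes at levels $\le T$ belong to the original tree). Market. Asset prices are $S_t(i)=(S_t^0,S_t^1(i),\dots,S_t^k(i))\in(0,\infty)^{k+1}$ for each node $i$ at level $t$; asset $0$ is risk-free (its price depends only on $t$). For $j\in\tilde I$ and $1\le i\le k$, $S^i_{T+1}(j)=\kappa_j^iS^i_T(j^-)$ with $\kappa_j^i>0$. The original market is arbitrage-free (no self-financing strategy with zero initial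 wealth has terminal wealth that is nonnegative a.s. and positive with positive probability). The claim is $G_0>0$ and $G_t(i)<0$ for $i\in I_t$, $1\le t\le T$. Probabilities. $\Delta_{m-1}=\{p\in\mathbb R^m_+:\sum_jp_j=1\}$; $p_j$ is the probability of terminal node $j$, with $p_j=0$ for $j\in\tilde I$. Strategies and perturbed feasible sets. $X\in\mathbb R^n$ is a family $X_t(i)\in\mathbb R^{k+1}$, $i\in I_t$, $0\le t\le T$. A claim perturbation $u\in\mathbb R^{N_T}$ has one component $u_t(i)$ per node $i\in I_t$, $0\le t\le T$. $\mathcal X(u)$ is the set of all $X$ with $X_t(i)\ge0$ componentwise for all $i\in I_t$, $0\le t\le T$; $\langle S_0,X_0\rangle\le G_0+u_0$; and $\langle S_t(i),X_t(i)-X_{t-1}(i^-)\rangle\le G_t(i)+u_t(i)$ for all $i\in I_t$, $1\le t\le T$. The unperturbed problem is assumed feasible: $\mathcal X(0)\neq\emptyset$. $\iota_C$ is the indicator function ($0$ on $C$, $+\infty$ off $C$). The dual function associated with $f:\mathbb R^{N_T}\times\mathbb R^n\to\overline{\mathbb R}$ is $\psi(y)=\inf_{(u,X)}\{f(u,X)-\langle y,u\rangle\}$. *)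

(* Defs.v *)
From HB Require Import structures.
From mathcomp Require Import all_boot all_order all_algebra.
From mathcomp Require Import boolp classical_sets reals constructive_ereal ereal.

Set Implicit Arguments.
Unset Strict Implicit.
Unset Printing Implicit Defensive.

Import Order.TTheory GRing.Theory Num.Theory.

Local Open Scope ring_scope.
Local Open Scope classical_set_scope.

(* A tree with levels 0, ..., T+1.  The nodes of levels 0, ..., T form the     *)
(* finite type [node], so that N_T = #|node|; the terminal nodes (level T+1)   *)
(* form the separate type 'I_m.  The value of [parent] at the root is          *)
(* irrelevant.  Removing the scenarios outside [original] leaves a tree with   *)
(* the same nodes at levels 0, ..., T, hence [original_child].                 *)
Record scenario_tree (T m : nat) := ScenarioTree {
  node : finType;
  level : node -> nat;
  tree_root : node;
  parent : node -> node;
  tparent : 'I_m -> node;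
  original : {set 'I_m};
  level_le : forall v, (level v <= T)%N;
  level_eq0 : forall v, level v = 0%N <-> v = tree_root;
  level_parent : forall v, (0 < level v)%N -> level v = (level (parent v)).+1;
  level_tparent : forall j, level (tparent j) = T;
  has_child : forall v, (level v < T)%N ->
    exists w, (0 < level w)%N /\ parent w = v;
  original_child : forall v, level v = T ->
    exists j, j \in original /\ tparent j = v
}.

Definition dot (R : realType) (d : nat) (x y : 'rV[R]_d) : R :=
  \sum_(i < d) x 0 i * y 0 i.

(* [price v] is S_t(v) for t = level v <= T and [tprice j] is S_{T+1}(j).      *)
(* Asset 0 is the index ord0 and assets 1, ..., k are the lift ord0 i, i : 'I_k. *)
Record market (R : realType) (T m k : nat) (tr : scenario_tree T m) := Market {
  price : node tr -> 'rV[R]_k.+1;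
  tprice : 'I_m -> 'rV[R]_k.+1;
  kappa : 'I_m -> 'I_k -> R;
  price_gt0 : forall v i, 0 < price v 0 i;
  tprice_gt0 : forall j i, 0 < tprice j 0 i;
  price_riskfree : forall v w, level v = level w ->
    price v 0 ord0 = price w 0 ord0;
  tprice_riskfree : forall j j', tprice j 0 ord0 = tprice j' 0 ord0;
  kappa_gt0 : forall j i, j \notin original tr -> 0 < kappa j i;
  tprice_critical : forall j i, j \notin original tr ->
    tprice j 0 (lift ord0 i) = kappa j i * price (tparent tr j) 0 (lift ord0 i)
}.

Definition strategy (R : realType) (T m k : nat) (tr : scenario_tree T m) :=
  {ffun node tr -> 'rV[R]_k.+1}.

Definition perturbation (R : realType) (T m : nat) (tr : scenario_tree T m) :=
  {ffun node tr -> R}.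

Definition pairing (R : realType) (T m : nat) (tr : scenario_tree T m)
    (y u : perturbation R tr) : R :=
  \sum_(v : node tr) y v * u v.

Definition simplex (R : realType) (m : nat) : set ('I_m -> R) :=
  [set p | (forall j, 0 <= p j) /\ \sum_(j < m) p j = 1].

Definition prob (R : realType) (m : nat) (q : 'I_m -> R) (A : pred 'I_m) : R :=
  \sum_(j < m | A j) q j.

Definition terminal_wealth (R : realType) (T m k : nat)
    (tr : scenario_tree T m) (M : market R k tr) (X : strategy R k tr)
    (j : 'I_m) : R :=
  dot (tprice M j) (X (tparent tr j)).

Definition self_financing (R : realType) (T m k : nat)
    (tr : scenario_tree T m) (M : market R k tr) (X : strategy R k tr) : Prop :=
  forall v, (0 < level v)%N -> dot (price M v) (X v - X (parent v)) = 0.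

(* The strategies here are unconstrained in sign; q is the law of the original *)
(* environment process on the terminal nodes.                                  *)
Definition arbitrage_free (R : realType) (T m k : nat)
    (tr : scenario_tree T m) (M : market R k tr) (q : 'I_m -> R) : Prop :=
  ~ exists X : strategy R k tr,
      [/\ self_financing M X,
          dot (price M (tree_root tr)) (X (tree_root tr)) = 0,
          prob q (fun j => 0 <= terminal_wealth M X j) = 1
        & 0 < prob q (fun j => 0 < terminal_wealth M X j)].

Definition feasible (R : realType) (T m k : nat) (tr : scenario_tree T m)
    (M : market R k tr) (G : node tr -> R) (u : perturbation R tr) :
    set (strategy R k tr) :=
  [set X : strategy R k tr | [/\ forall v i, 0 <= X v 0 i,
      dot (price M (tree_root tr)) (X (tree_root tr)) <= G (tree_root tr) + u (tree_root tr)
    & forall v, (0 < level v)%N ->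
        dot (price M v) (X v - X (parent v)) <= G v + u v]].

(* The indicator function of convex analysis, not the 0-1 valued \1_C.         *)
Definition iota_set (R : realType) (A : Type) (C : set A) (x : A) : \bar R :=
  if `[< C x >] then 0%E else +oo%E.

Definition f2 (R : realType) (T m k : nat) (tr : scenario_tree T m)
    (M : market R k tr) (G : node tr -> R) (p : 'I_m -> R)
    (u : perturbation R tr) (X : strategy R k tr) : \bar R :=
  ((- \sum_(j < m) p j * dot (tprice M j) (X (tparent tr j)))%:E
   + iota_set R (feasible M G u) X)%E.

Definition dual_function (R : realType) (T m k : nat) (tr : scenario_tree T m)
    (f : perturbation R tr -> strategy R k tr -> \bar R)
    (y : perturbation R tr) : \bar R :=
  ereal_inf [set z | exists u X, z = (f u X - (pairing y u)%:E)%E].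

Definition psi2 (R : realType) (T m k : nat) (tr : scenario_tree T m)
    (M : market R k tr) (G : node tr -> R) (p : 'I_m -> R) :
    perturbation R tr -> \bar R :=
  dual_function (f2 M G p).

Definition phi (R : realType) (T m k : nat) (tr : scenario_tree T m)
    (M : market R k tr) (G : node tr -> R) (p : 'I_m -> R)
    (X : strategy R k tr) : \bar R :=
  f2 M G p 0 X.

Definition is_min (R : realType) (A : Type) (g : A -> \bar R) (z : \bar R) :
    Prop :=
  (exists x, g x = z) /\ (forall x, (z <= g x)%E).

(* Main.v *)
(** Since the prices are positive and short positions are forbidden, the primal
    problem is a finite linear program: maximise a linear function over [x >= 0]
    and [A x <= G].  Its linear programming dual asks for [l >= 0] on the nodes
    with [l A >= c], and [y = - l] is then a point where [psi2 y >= - l G].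
    Letting [l] grow geometrically towards the root gives a dual feasible
    point, so strong linear programming duality applies, a consequence of
    Farkas' lemma (proved by Fourier-Motzkin elimination) for the system
    [x >= 0], [l >= 0], [A x <= G], [l A >= c], [l G <= c x]. *)
Require Import Defs.
From HB Require Import structures.
From mathcomp Require Import all_boot all_order all_algebra.
From mathcomp Require Import boolp classical_sets reals constructive_ereal ereal.
From mathcomp Require Import lra.

Set Implicit Arguments.
Unset Strict Implicit.
Unset Printing Implicit Defensive.

Import Order.TTheory GRing.Theory Num.Theory.

Local Open Scope ring_scope.
Local Open Scope classical_set_scope.

(** * Fourier-Motzkin elimination of one variable *)

Lemma exists_between (R : realFieldType) (I : finType) (P Q : pred I)
    (f : I -> R) :
    (forall i j, P i -> Q j -> f i <= f j) ->
  exists t, (forall i, P i -> f i <= t) /\ (forall j, Q j -> t <= f j).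
Proof.
move=> fPQ; case: (pickP P) => [i0 Pi0|P0].
  case: (Order.TotalTheory.arg_maxP f Pi0) => i Pi fi.
  by exists (f i); split=> [j Pj|j Qj]; [exact: fi|exact: fPQ].
case: (pickP Q) => [j0 Qj0|Q0].
  case: (Order.TotalTheory.arg_minP f Qj0) => j Qj fj.
  by exists (f j); split=> [i|i Qi]; [rewrite P0|exact: fj].
by exists 0; split=> i; rewrite ?P0 ?Q0.
Qed.

Section FourierMotzkin.
Variables (R : realFieldType) (I : finType) (c : I -> R).

(* The multipliers that cancel the variable with coefficients [c]: an
   inequality without this variable is kept, and two inequalities in which it
   has opposite signs are combined; the other indices yield [0 <= 0]. *)
Definition fm_coef (s : I + I * I) (k : I) : R :=
  match s with
  | inl i => ((c i == 0) && (k == i))%:R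
  | inr (i, j) => if (0 < c i) && (c j < 0)
                  then (k == i)%:R * - c j + (k == j)%:R * c i else 0
  end.

Lemma fm_coef_ge0 s k : 0 <= fm_coef s k.
Proof.
case: s => [i|[i j]] /=; first exact: ler0n.
case: ifP => // /andP[ci cj].
by rewrite addr_ge0// mulr_ge0 ?ler0n ?oppr_ge0 ?ltW.
Qed.

Lemma sum_delta (i : I) (f : I -> R) : \sum_k (k == i)%:R * f k = f i.
Proof.
rewrite (bigD1 i)//= eqxx mul1r big1 ?addr0// => k /negPf ->.
by rewrite mul0r.
Qed.

Lemma fm_coef_inl i (r : I -> R) : c i = 0 ->
  \sum_k fm_coef (inl i) k * r k = r i.
Proof. by move=> ci; rewrite /= ci eqxx sum_delta. Qed.

Lemma fm_coef_inr i j (r : I -> R) : 0 < c i -> c j < 0 ->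
  \sum_k fm_coef (inr (i, j)) k * r k = c i * r j - c j * r i.
Proof.
move=> ci cj; rewrite /= ci cj /=.
under eq_bigr do rewrite mulrDl -!mulrA.
by rewrite big_split /= !sum_delta mulNr addrC.
Qed.

Lemma fm_coef_cancel s : \sum_k fm_coef s k * c k = 0.
Proof.
case: s => [i|[i j]].
  have [ci|ci] := eqVneq (c i) 0; first by rewrite fm_coef_inl.
  by rewrite big1// => k _; rewrite /= (negPf ci) mul0r.
have [/andP[ci cj]|/negPf cij] := boolP ((0 < c i) && (c j < 0)).
  by rewrite fm_coef_inr// mulrC subrr.
by rewrite big1// => k _; rewrite /= cij mul0r.
Qed.

(** Rows with [c i < 0] bound [t] below by [r i / c i], rows with [0 < c i] bound it above. The
    [inr] combinations put every lower bound under every upper bound; the [inl] ones settle the rows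
    with [c i = 0]. *)
Lemma fm_solve (r : I -> R) : (forall s, 0 <= \sum_k fm_coef s k * r k) ->
  exists t, forall i, c i * t <= r i.
Proof.
move=> r_ge0.
have [i j cj ci|t [tl tu]] := @exists_between R I (fun i => c i < 0)
    (fun i => 0 < c i) (fun i => r i / c i).
  have := r_ge0 (inr (j, i)); rewrite fm_coef_inr// subr_ge0 => h.
  rewrite ler_ndivrMr// mulrAC ler_pdivrMr//.
  by rewrite [X in X <= _]mulrC [X in _ <= X]mulrC.
exists t => i; case: (ltrgt0P (c i)) => ci.
- by rewrite mulrC -ler_pdivlMr//; exact: tu.
- by rewrite mulrC -ler_ndivrMr//; exact: tl.
- by have := r_ge0 (inl i); rewrite fm_coef_inl// ci mul0r.
Qed.

End FourierMotzkin.

(** * Farkas' lemma *)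

Lemma farkas_seq (R : realFieldType) (V : eqType) (s : seq V) (I : finType)
    (a : I -> V -> R) (b : I -> R) : uniq s ->
  (exists x : V -> R, forall i, \sum_(v <- s) a i v * x v <= b i) \/
  (exists l : I -> R, [/\ forall i, 0 <= l i,
     forall v, v \in s -> \sum_i l i * a i v = 0 & \sum_i l i * b i < 0]).
Proof.
(* Eliminating a variable replaces the index type [I] by [I + I * I], so the system is generalised
   along with the list. *)
elim: s I a b => [|v s IHs] I a b /=.
  move=> _; case: (pickP (fun i => b i < 0)) => [i bi|b_ge0].
    right; exists (fun k => (k == i)%:R); split=> //.
    by rewrite sum_delta.
  by left; exists (fun=> 0) => i; rewrite big_nil leNgt b_ge0.
move=> /andP[vs us].
pose e := fm_coef (a^~ v).
case: (IHs _ (fun t w => \sum_k e t k * a k w) (fun t => \sum_k e t k * b k) us).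
  move=> [x xP]; left.
  (* Once [x] is substituted for the remaining variables, only the value at [v] is unknown; the
     eliminated system at [x] is the solvability condition. *)
  have [t|t tP] := @fm_solve R I (a^~ v)
      (fun k => b k - \sum_(w <- s) a k w * x w).
    under eq_bigr do rewrite mulrBr mulr_sumr.
    rewrite sumrB subr_ge0 exchange_big /=.
    under eq_bigr do under eq_bigr do rewrite mulrA.
    by under eq_bigr do rewrite -mulr_suml; exact: xP.
  exists (fun w => if w == v then t else x w) => i.
  rewrite big_cons eqxx -lerBrDr; apply: le_trans (tP i) _.
  rewrite lerD2l lerN2 le_eqVlt; apply/orP; left; apply/eqP.
  apply: eq_big_seq => w ws; case: eqP => // wv.
  by rewrite -wv ws in vs.
move=> [l [l_ge0 la lb]]; right.
(* A certificate for the eliminated system, composed with [e], is one for the original system; the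
   column of [v] cancels by construction. *)
have comb (f : I -> R) : \sum_k (\sum_t l t * e t k) * f k =
    \sum_t l t * \sum_k e t k * f k.
  under eq_bigr do rewrite mulr_suml.
  rewrite exchange_big; apply: eq_bigr => t _; rewrite mulr_sumr.
  by apply: eq_bigr => k _; rewrite mulrA.
exists (fun k => \sum_t l t * e t k); split=> [k|w|].
- by apply: sumr_ge0 => t _; rewrite mulr_ge0 ?fm_coef_ge0.
- rewrite comb inE => /predU1P[->|ws]; last exact: la.
  by rewrite big1// => t _; rewrite fm_coef_cancel mulr0.
- by rewrite comb.
Qed.

Lemma farkas (R : realFieldType) (V I : finType) (a : I -> V -> R)
    (b : I -> R) :
  (exists x : V -> R, forall i, \sum_v a i v * x v <= b i) \/
  (exists l : I -> R, [/\ forall i, 0 <= l i,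
     forall v, \sum_i l i * a i v = 0 & \sum_i l i * b i < 0]).
Proof.
case: (farkas_seq a b (index_enum_uniq V)) => [|[l [l0 la lb]]]; first by left.
by right; exists l; split=> // v; exact/la/mem_index_enum.
Qed.

(** * Strong duality for linear programs *)

Lemma mul_sum_exchange (R : realFieldType) (V J : finType) (A : J -> V -> R)
    (l : J -> R) (x : V -> R) :
  \sum_v (\sum_j l j * A j v) * x v = \sum_j l j * \sum_v A j v * x v.
Proof.
under eq_bigr do rewrite mulr_suml.
rewrite exchange_big; apply: eq_bigr => j _; rewrite mulr_sumr.
by apply: eq_bigr => v _; rewrite mulrA.
Qed.

Lemma lp_duality (R : realFieldType) (V J : finType) (A : J -> V -> R)
    (b : J -> R) (c : V -> R) (x0 : V -> R) (l0 : J -> R) :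
    (forall v, 0 <= x0 v) -> (forall j, \sum_v A j v * x0 v <= b j) ->
    (forall j, 0 <= l0 j) -> (forall v, c v <= \sum_j l0 j * A j v) ->
  exists (x : V -> R) (l : J -> R),
    [/\ forall v, 0 <= x v, forall j, \sum_v A j v * x v <= b j,
        forall j, 0 <= l j, forall v, c v <= \sum_j l j * A j v
      & \sum_j l j * b j <= \sum_v c v * x v].
Proof.
move=> x0_ge0 x0P l0_ge0 l0P.
(* The unknowns are [x] on [inl] and [l] on [inr]. The rows are, in order, the sign conditions,
   [A x <= b], [- l A <= - c] and the gap condition [l b - c x <= 0]. *)
pose a (i : (V + J) + (J + V) + unit) (z : V + J) : R :=
  match i, z with
  | inl (inl t), _ => - (t == z)%:R
  | inl (inr (inl j)), inl v => A j v
  | inl (inr (inl j)), inr _ => 0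
  | inl (inr (inr v)), inl _ => 0
  | inl (inr (inr v)), inr j => - A j v
  | inr _, inl v => - c v
  | inr _, inr j => b j
  end.
pose d (i : (V + J) + (J + V) + unit) : R :=
  match i with
  | inl (inr (inl j)) => b j
  | inl (inr (inr v)) => - c v
  | _ => 0
  end.
have sumD (K : finType) (k : K) (f : K -> R) :
    \sum_z - (k == z)%:R * f z = - f k.
  under eq_bigr do rewrite mulNr eq_sym.
  by rewrite sumrN sum_delta.
case: (farkas a d) => [[z zP]|[l [l_ge0 la]]].
  exists (fun v => z (inl v)), (fun j => z (inr j)); split=> [v|j|j|v|].
  - by have := zP (inl (inl (inl v))); rewrite sumD oppr_le0.
  - have := zP (inl (inr (inl j))); rewrite big_sumType /=.
    by rewrite [X in _ + X]big1 ?addr0// => i _; rewrite mul0r.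
  - by have := zP (inl (inl (inr j))); rewrite sumD oppr_le0.
  - have := zP (inl (inr (inr v))); rewrite big_sumType /=.
    rewrite big1 ?add0r => [|i _]; last by rewrite mul0r.
    under eq_bigr do rewrite mulNr mulrC.
    by rewrite sumrN lerN2.
  - have := zP (inr tt); rewrite big_sumType /=.
    under eq_bigr do rewrite mulNr.
    rewrite sumrN addrC subr_le0.
    by under eq_bigr do rewrite mulrC.
(* In a certificate the roles swap: up to the factor [tau], the multipliers [mu] of the primal rows
   form a dual point and the multipliers [xi] of the dual rows a primal point. The sign rows only
   turn the column equations into inequalities. *)
pose mu j := l (inl (inr (inl j))).
pose xi v := l (inl (inr (inr v))).
pose tau := l (inr tt).
have sumU (f : unit -> R) : \sum_i f i = f tt.
  by rewrite (bigD1 tt)//= big1 ?addr0// => -[].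
have sumN (K : finType) (k : K) (f : K -> R) :
    \sum_z f z * - (z == k)%:R = - f k.
  under eq_bigr do rewrite mulrN mulrC.
  by rewrite sumrN sum_delta.
have muA v : tau * c v <= \sum_j mu j * A j v.
  have := la (inl v); rewrite !big_sumType /= sumU /= !sumN.
  have -> : \sum_i l (inl (inl (inr i))) * - (inr i == inl v :> V + J)%:R = 0.
    by rewrite big1// => i _; rewrite oppr0 mulr0.
  rewrite [X in _ + (_ + X)]big1 => [|i _]; last by rewrite mulr0.
  have := l_ge0 (inl (inl (inl v))); rewrite /mu /tau; lra.
have Axi j : \sum_v A j v * xi v <= tau * b j.
  have := la (inr j); rewrite !big_sumType /= sumU /= !sumN.
  have -> : \sum_i l (inl (inl (inl i))) * - (inl i == inr j :> V + J)%:R = 0.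
    by rewrite big1// => i _; rewrite oppr0 mulr0.
  rewrite [X in _ + (X + _)]big1 => [|i _]; last by rewrite mulr0.
  under [X in _ + (_ + X)]eq_bigr do rewrite mulrN mulrC.
  rewrite sumrN.
  have := l_ge0 (inl (inl (inr j))); rewrite /xi /tau; lra.
rewrite !big_sumType /= sumU /= mulr0 addr0.
under eq_bigr do rewrite mulr0.
under [X in _ + X + _]eq_bigr do rewrite mulr0.
rewrite !big1_eq addr0 add0r.
under [X in _ + X]eq_bigr do rewrite mulrN mulrC.
rewrite sumrN -/mu -/xi subr_lt0 ltNge => /negP[].
have le_sum_mul (K : finType) (f g h : K -> R) : (forall k, 0 <= h k) ->
    (forall k, f k <= g k) -> \sum_k f k * h k <= \sum_k g k * h k.
  by move=> h0 fg; apply: ler_sum => k _; exact: ler_wpM2r.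
have xi_ge0 v : 0 <= xi v by exact: l_ge0.
have mu_ge0 j : 0 <= mu j by exact: l_ge0.
have scale (K : finType) (f g : K -> R) :
    \sum_k (tau * f k) * g k = tau * \sum_k f k * g k.
  by rewrite mulr_sumr; apply: eq_bigr => k _; rewrite mulrA.
have swap (K : finType) (f g : K -> R) :
    \sum_k f k * g k = \sum_k g k * f k.
  by apply: eq_bigr => k _; rewrite mulrC.
have := l_ge0 (inr tt); rewrite -/tau le_eqVlt => /predU1P[tau0|tau_gt0].
  (* A degenerate certificate contradicts the feasibility of [x0] or [l0]. *)
  apply: (@le_trans _ _ 0).
    apply: le_trans (le_sum_mul _ _ _ _ xi_ge0 l0P) _.
    rewrite mul_sum_exchange; apply: sumr_le0 => j _.
    by rewrite mulr_ge0_le0//; have := Axi j; rewrite -tau0 mul0r.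
  apply: (@le_trans _ _ (\sum_j mu j * \sum_v A j v * x0 v)).
    rewrite -mul_sum_exchange; apply: sumr_ge0 => v _.
    by rewrite mulr_ge0//; have := muA v; rewrite -tau0 mul0r.
  by rewrite swap [leRHS]swap; exact: le_sum_mul.
(* This is weak duality for [xi / tau] and [mu / tau], cleared of denominators:
   [tau c xi <= mu A xi <= tau mu b]. *)
rewrite -(ler_pM2l tau_gt0) -scale [X in _ <= _ * X]swap -scale.
apply: le_trans (le_sum_mul _ _ _ _ xi_ge0 muA) _.
by rewrite mul_sum_exchange swap; exact: le_sum_mul.
Qed.

(** * The market problem as a linear program *)

Section MarketLP.
Variables (R : realType) (T k m : nat) (tr : scenario_tree T m).
Variables (M : market R k tr) (p : 'I_m -> R).

Local Notation asset := (node tr * 'I_k.+1)%type.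

(** The value 0 at the root gives the initial budget constraint the same form as the later ones. *)
Definition parent_holding (X : strategy R k tr) (v : node tr) : 'rV[R]_k.+1 :=
  if (0 < level v)%N then X (parent v) else 0.

Definition budget_coef (w : node tr) (z : asset) : R :=
  price M w 0 z.2 * ((z.1 == w)%:R - ((0 < level w)%N && (z.1 == parent w))%:R).

Definition payoff_coef (z : asset) : R :=
  \sum_(j < m | tparent tr j == z.1) p j * tprice M j 0 z.2.

Lemma level_root : level (tree_root tr) = 0%N.
Proof. by apply/level_eq0. Qed.

Lemma feasibleE (G : node tr -> R) (u : perturbation R tr)
    (X : strategy R k tr) :
  feasible M G u X <-> (forall v i, 0 <= X v 0 i) /\
    (forall v, dot (price M v) (X v - parent_holding X v) <= G v + u v).
Proof.
rewrite /feasible /parent_holding /=; split=> [[X0 Xr XP]|[X0 XP]].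
  split=> // v; case: ifP => [|/negbT]; first exact: XP.
  by rewrite -eqn0Ngt => /eqP/level_eq0 ->; rewrite subr0.
split=> // [|v v0]; last by have := XP v; rewrite v0.
by have := XP (tree_root tr); rewrite level_root subr0.
Qed.

Lemma sum_budget_coef (X : strategy R k tr) w :
  \sum_(z : asset) budget_coef w z * X z.1 0 z.2 =
  dot (price M w) (X w - parent_holding X w).
Proof.
rewrite -(pair_bigA _ (fun v i => budget_coef w (v, i) * X v 0 i)) /= exchange_big /=.
apply: eq_bigr => i _; rewrite !mxE.
rewrite /budget_coef /parent_holding /=.
under eq_bigr do rewrite -mulrA mulrBl.
rewrite -mulr_sumr sumrB (sum_delta w (fun v => X v 0 i)); congr (_ * (_ - _)).
case: ifP => _ /=; first by rewrite (sum_delta _ (fun v => X v 0 i)).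
by rewrite mxE big1// => v _; rewrite mul0r.
Qed.

Lemma sum_payoff_coef (X : strategy R k tr) :
  \sum_(z : asset) payoff_coef z * X z.1 0 z.2 =
  \sum_(j < m) p j * dot (tprice M j) (X (tparent tr j)).
Proof.
rewrite -(pair_bigA _ (fun v i => payoff_coef (v, i) * X v 0 i)) /=.
rewrite (partition_big (tparent tr) xpredT) //=.
apply: eq_bigr => v _; rewrite /payoff_coef /=.
under eq_bigr do rewrite mulr_suml.
rewrite exchange_big /=; apply: eq_bigr => j /eqP <-.
by rewrite mulr_sumr; apply: eq_bigr => i _; rewrite mulrA.
Qed.

Hypothesis hp : simplex p.

(** In the column of a node, its own weighted price must cover its terminal payoffs and the weighted
    prices of its children. Weights that gain a large factor [K] per level towards the root achieve
    this, as all prices are positive. *)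
Lemma dual_feasible_point : exists l : node tr -> R,
  (forall v, 0 <= l v) /\
  (forall z, payoff_coef z <= \sum_w l w * budget_coef w z).
Proof.
have p0 := hp.1.
have p1 j : p j <= 1.
  rewrite -hp.2 (bigD1 j)//= lerDl; exact: sumr_ge0.
have pg := price_gt0 M; have tg := tprice_gt0 M.
pose S := \sum_(i < k.+1) (\sum_w price M w 0 i + \sum_j tprice M j 0 i).
have S_ge i : \sum_w price M w 0 i + \sum_j tprice M j 0 i <= S.
  rewrite /S (bigD1 i)//= lerDl; apply: sumr_ge0 => h _.
  by rewrite addr_ge0// sumr_ge0// => j _; rewrite ltW.
have price0 i : 0 <= \sum_w price M w 0 i.
  by apply: sumr_ge0 => w _; rewrite ltW.
have tprice0 i : 0 <= \sum_j tprice M j 0 i.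
  by apply: sumr_ge0 => j _; rewrite ltW.
have S0 : 0 <= S := le_trans (addr_ge0 (price0 ord0) (tprice0 ord0)) (S_ge ord0).
(* [K] is chosen so that [K] times any single price exceeds or equals [S], which bounds the total of
   all prices of any one asset. *)
pose K := \sum_(z : asset) S / price M z.1 0 z.2.
have K_ge v i : S <= K * price M v 0 i.
  rewrite -ler_pdivrMr// /K (bigD1 (v, i))//= lerDl.
  by apply: sumr_ge0 => z _; rewrite divr_ge0// ltW.
have K0 : 0 <= K by apply: sumr_ge0 => z _; rewrite divr_ge0// ltW.
have [l lE] : exists l : node tr -> R, forall v, l v = K ^+ (T - level v).+1.
  by exists (fun v => K ^+ (T - level v).+1).
have l0 v : 0 <= l v by rewrite lE exprn_ge0.
exists l; split=> // -[v i].
have -> : \sum_w l w * budget_coef w (v, i) =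
    l v * price M v 0 i -
    \sum_(w | (0 < level w)%N && (v == parent w)) l w * price M w 0 i.
  rewrite /budget_coef /=.
  under eq_bigr do rewrite mulrA mulrBr eq_sym.
  rewrite sumrB; congr (_ - _).
    under eq_bigr do rewrite mulrC.
    by rewrite (sum_delta v (fun w => l w * price M w 0 i)).
  rewrite [RHS]big_mkcond /=; apply: eq_bigr => w _.
  by case: ifP; rewrite ?mulr1 ?mulr0.
rewrite /payoff_coef /=.
(* Nodes at level [T] carry payoffs but have no children in [node]; at lower levels it is the
   reverse. *)
have [vT|vT] := eqVneq (level v) T.
  rewrite [X in _ - X]big1 ?subr0 => [|w /andP[w0 /eqP vw]].
    rewrite lE vT subnn expr1; apply: le_trans (K_ge v i).
    apply: (@le_trans _ _ (\sum_j tprice M j 0 i)); last first.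
      by apply: le_trans (S_ge i); rewrite lerDr.
    rewrite big_mkcond; apply: ler_sum => j _; case: ifP => _; last exact: ltW.
    by rewrite ler_piMl// ltW.
  by have := level_le w; rewrite (level_parent w0) -vw vT ltnn.
rewrite big1 => [|j /eqP jv]; last by rewrite -jv level_tparent eqxx in vT.
have vltT : (level v < T)%N by rewrite ltn_neqAle vT level_le.
rewrite subr_ge0 lE exprSr -mulrA.
apply: (@le_trans _ _ (K ^+ (T - level v) * \sum_w price M w 0 i)).
  rewrite mulr_sumr big_mkcond; apply: ler_sum => w _.
  case: ifP => [/andP[w0 /eqP vw]|_]; last by rewrite mulr_ge0 ?exprn_ge0// ltW.
  by rewrite lE (level_parent w0) -vw subnSK.
rewrite ler_wpM2l ?exprn_ge0//; apply: le_trans (K_ge v i).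
by apply: le_trans (S_ge i); rewrite lerDl.
Qed.

End MarketLP.

(** * Duality for the market problem *)

Lemma weak_duality (R : realType) (T k m : nat) (tr : scenario_tree T m)
    (M : market R k tr) (G : node tr -> R) (p : 'I_m -> R)
    (y : perturbation R tr) (X : strategy R k tr) :
  (psi2 M G p y <= phi M G p X)%E.
Proof.
apply: ereal_inf_lbound; exists 0, X.
rewrite /pairing big1 ?sube0// => v _.
by rewrite ffunE mulr0.
Qed.

Lemma phi_feasible (R : realType) (T k m : nat) (tr : scenario_tree T m)
    (M : market R k tr) (G : node tr -> R) (p : 'I_m -> R)
    (X : strategy R k tr) : feasible M G 0 X ->
  phi M G p X =
    (- \sum_(z : node tr * 'I_k.+1) payoff_coef M p z * X z.1 0 z.2)%:E.
Proof.
move=> XP; rewrite /phi /f2 /iota_set asboolT// adde0.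
by rewrite sum_payoff_coef.
Qed.

(** For [X] feasible under [u], the payoff is at most [l A X <= l (G + u)], and the term in [u]
    cancels against the pairing with [- l]. Infeasible pairs have value [+oo]. *)
Lemma psi2_lower_bound (R : realType) (T k m : nat) (tr : scenario_tree T m)
    (M : market R k tr) (G : node tr -> R) (p : 'I_m -> R)
    (l : node tr -> R) : (forall v, 0 <= l v) ->
    (forall z, payoff_coef M p z <= \sum_w l w * budget_coef M w z) ->
  ((- \sum_v l v * G v)%:E <= psi2 M G p [ffun v => (- l v)%R])%E.
Proof.
move=> l0 lP; apply/ereal_infP => _ [u [X ->]].
rewrite /f2 /iota_set; case: asboolP => [/feasibleE[X0 XP]|_]; last first.
  by rewrite addey// addye// leey.
rewrite adde0 -EFinB lee_fin -sum_payoff_coef /pairing.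
have -> : \sum_v [ffun v => - l v] v * u v = - \sum_v l v * u v.
  by rewrite -sumrN; apply: eq_bigr => v _; rewrite ffunE mulNr.
have : \sum_(z : node tr * 'I_k.+1) payoff_coef M p z * X z.1 0 z.2 <=
    \sum_v l v * G v + \sum_v l v * u v.
  apply: (@le_trans _ _ (\sum_(z : node tr * 'I_k.+1)
      (\sum_w l w * budget_coef M w z) * X z.1 0 z.2)).
    by apply: ler_sum => z _; exact: ler_wpM2r.
  rewrite mul_sum_exchange -big_split /=; apply: ler_sum => v _.
  by rewrite -mulrDr ler_wpM2l// sum_budget_coef.
lra.
Qed.

Theorem theorem4p14 (R : realType) (T k m : nat) (hT : (1 <= T)%N)
    (hk : (1 <= k)%N) (tr : scenario_tree T m) (M : market R k tr)
    (q : 'I_m -> R) (hq : simplex q)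
    (hq_supp : forall j, (0 < q j) = (j \in original tr))
    (hNA : arbitrage_free M q)
    (G : node tr -> R) (hG0 : 0 < G (tree_root tr))
    (hG : forall v, (0 < level v)%N -> G v < 0)
    (hfeas : feasible M G 0 !=set0)
    (p : 'I_m -> R) (hp : simplex p)
    (hp0 : forall j, j \notin original tr -> p j = 0) :
  is_min (phi M G p) (ereal_sup (range (psi2 M G p))).
Proof.
have sup_le X : (ereal_sup (range (psi2 M G p)) <= phi M G p X)%E.
  by apply/ereal_supP => _ [y _ <-]; exact: weak_duality.
split=> //.
case: hfeas => X0 /feasibleE[X0_ge0 X0P].
have [l0 [l0_ge0 l0P]] := dual_feasible_point M hp.
have [||x [l [x_ge0 xP l_ge0 lP gap]]] := lp_duality
    (x0 := fun z => X0 z.1 0 z.2) (b := G) _ _ l0_ge0 l0P.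
- by [].
- by move=> v; rewrite sum_budget_coef; have := X0P v; rewrite ffunE addr0.
pose X : strategy R k tr := [ffun v => \row_i x (v, i)].
have XE z : X z.1 0 z.2 = x z by rewrite /X ffunE mxE; case: z.
have XP : feasible M G 0 X.
  apply/feasibleE; split=> [v i|v]; first by rewrite (XE (v, i)).
  rewrite -sum_budget_coef ffunE addr0.
  by under eq_bigr do rewrite XE.
exists X; apply/eqP; rewrite eq_le sup_le andbT.
(* The dual optimum [l] closes the gap: [phi X = - c x <= - l G <= psi2 (- l)], which is below the
   supremum. *)
apply: (@le_trans _ _ (psi2 M G p [ffun v => - l v])); last first.
  by apply: ereal_sup_ubound; exists [ffun v => - l v].
apply: le_trans (psi2_lower_bound G l_ge0 lP).
rewrite phi_feasible// lee_fin lerN2.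
by under [leRHS]eq_bigr do rewrite XE.
Qed.
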